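(* Let $\mathcal{X}=\Delta(n)$ be the probability simplex in $\mathbb{R}^n$ and $\mathcal{C}=\mathrm{cone}(\{1\}\times\Delta(n))\subset\mathbb{R}^{n+1}$. For every $\boldsymbol{u}=(\tilde u,\hat{\boldsymbol{u}})\in\mathbb{R}\times\mathbb{R}^n$, an optimal solution $\pi_{\mathcal{C}^\circ}(\boldsymbol{u})$ to $$\min\Big\{(\tilde y-\tilde u)^2+\|\hat{\boldsymbol{y}}-\hat{\boldsymbol{u}}\|_2^2\;:\;(\tilde y,\hat{\boldsymbol{y}})\in\mathbb{R}\times\mathbb{R}^n,\ \max_{i\in[n]}\hat y_i\le-\tilde y\Big\}$$ can be computed in $O(n\log n)$ arithmetic operations. Therefore, $\pi_{\mathcal{C}}(\boldsymbol{u})$ can be computed in $O(n\log n)$ arithmetic operations.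
   Context: $\mathrm{cone}(\{1\}\times\Delta(n))=\{\alpha(1,\boldsymbol{x}):\alpha\ge0,\boldsymbol{x}\in\Delta(n)\}$; $\mathcal{C}^\circ=\{\boldsymbol{z}\in\mathbb{R}^{n+1}:\langle\boldsymbol{z},\hat{\boldsymbol{z}}\rangle\le0\ \forall\hat{\boldsymbol{z}}\in\mathcal{C}\}$ is the polar cone; $\pi_K$ denotes the Euclidean orthogonal projection onto a closed convex set $K$. Arithmetic operations are counted over the reals: each addition, subtraction, multiplication, division and comparison counts as one operation. *)

(* Defs.v *)
From mathcomp Require Import all_boot all_order all_algebra.
From mathcomp Require Import all_classical all_reals all_analysis.
Set Implicit Arguments.
Unset Strict Implicit.
Unset Printing Implicit Defensive.
Import Order.TTheory GRing.Theory Num.Theory.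
Import numFieldNormedType.Exports.
Local Open Scope classical_set_scope.
Local Open Scope ring_scope.

(** * Euclidean geometry in R^(n+1) = R x R^n *)

(* [R^o] is [R] seen as a module over itself: this gives [epoint R n] its
   vector space operations.  The library's norm on [epoint R n] is a sup norm,
   so the Euclidean structure is defined explicitly. *)
Definition epoint (R : realType) (n : nat) : Type := (R^o * 'rV[R]_n)%type.

Definition dot (R : realType) n (x y : 'rV[R]_n) : R :=
  \sum_(i < n) x 0 i * y 0 i.

Definition norm2 (R : realType) n (x : 'rV[R]_n) : R := Num.sqrt (dot x x).

Definition inner (R : realType) n (z w : epoint R n) : R :=
  z.1 * w.1 + dot z.2 w.2.

Definition enorm (R : realType) n (z : epoint R n) : R :=
  Num.sqrt (inner z z).

Definition simplex (R : realType) n : set 'rV[R]_n :=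
  [set x | (forall i, 0 <= x 0 i) /\ \sum_(i < n) x 0 i = 1].

Definition cone (R : realType) n (S : set (epoint R n)) : set (epoint R n) :=
  [set w | exists2 a : R, 0 <= a & exists2 z, S z & w = (a * z.1, a *: z.2)].

Definition simplex_cone (R : realType) n : set (epoint R n) :=
  cone ([set (1 : R^o)] `*` @simplex R n).

Definition polar (R : realType) n (K : set (epoint R n)) : set (epoint R n) :=
  [set z | forall w, K w -> inner z w <= 0].

Definition minimizers (R : realType) (T : Type) (F : set T) (f : T -> R) :
    set T :=
  [set x | F x /\ forall y, F y -> f x <= f y].

(* [xget] picks an element of the set of nearest points, which is a singleton
   when [K] is nonempty, closed and convex; the default [u] is only used if
   there is no nearest point. *)
Definition orth_proj (R : realType) n (K : set (epoint R n)) (u : epoint R n) :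
    epoint R n :=
  xget u (minimizers K (fun p => enorm (p - u))).

(* The maximum is taken in the extended reals, with unit -oo. *)
Definition max_feasible (R : realType) n : set (epoint R n) :=
  [set y : epoint R n |
    (\big[maxe/-oo]_(i < n) (y.2 0 i)%:E <= (- y.1)%:E)%E].

Definition sq_objective (R : realType) n (u y : epoint R n) : R :=
  (y.1 - u.1) ^+ 2 + norm2 (y.2 - u.2) ^+ 2.

(** * A real random access machine

   A single finite program handles all dimensions.  It works on natural
   number variables [ivar], used for control flow and addressing, and on an
   unbounded array [cell] of real numbers.  Reals influence these variables
   only through comparisons.  The cost of an execution is its number of real
   additions, subtractions, multiplications, divisions and comparisons; index
   bookkeeping, data movement and loading literals are not counted. *)

Inductive iexp :=
  | IVar (x : nat)
  | INum (k : nat)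
  | IAdd (a b : iexp)
  | ISub (a b : iexp)
  | IMul (a b : iexp)
  | IDiv (a b : iexp).

Fixpoint ieval (s : nat -> nat) (a : iexp) : nat :=
  match a with
  | IVar x => s x
  | INum k => k
  | IAdd a b => ieval s a + ieval s b
  | ISub a b => ieval s a - ieval s b
  | IMul a b => ieval s a * ieval s b
  | IDiv a b => ieval s a %/ ieval s b
  end%N.

Inductive arith_op := OpAdd | OpSub | OpMul | OpDiv.

Definition op_eval (R : realType) (o : arith_op) (x y : R) : R :=
  match o with
  | OpAdd => x + y
  | OpSub => x - y
  | OpMul => x * y
  | OpDiv => x / y
  end.

Inductive prog :=
  | Skip
  | Seq (p q : prog)
  | ISet (x : nat) (a : iexp)           (* x := a *)
  | IIf (a b : iexp) (p q : prog)       (* if a < b then p else q *)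
  | IWhile (a b : iexp) (p : prog)      (* while a < b do p *)
  | RLit (d : iexp) (k : nat)           (* cell[d] := k *)
  | RCopy (d a : iexp)                  (* cell[d] := cell[a] *)
  | ROp (o : arith_op) (d a b : iexp)   (* cell[d] := cell[a] o cell[b] *)
  | RIf (a b : iexp) (p q : prog).      (* if cell[a] <= cell[b] then p else q *)

Record state (R : realType) := State { ivar : nat -> nat; cell : nat -> R }.

Definition upd (T : Type) (f : nat -> T) (i : nat) (v : T) : nat -> T :=
  fun j => if j == i then v else f j.

Definition iset (R : realType) (s : state R) (x v : nat) : state R :=
  State (upd (ivar s) x v) (cell s).

Definition rset (R : realType) (s : state R) (d : nat) (v : R) : state R :=
  State (ivar s) (upd (cell s) d v).

(* [exec p s k s']: started in [s], [p] terminates in [s'] at cost [k].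
   Division by zero has no execution. *)
Inductive exec (R : realType) : prog -> state R -> nat -> state R -> Prop :=
  | ExecSkip s : exec Skip s 0 s
  | ExecSeq p q s1 s2 s3 k l :
      exec p s1 k s2 -> exec q s2 l s3 -> exec (Seq p q) s1 (k + l) s3
  | ExecISet x a s : exec (ISet x a) s 0 (iset s x (ieval (ivar s) a))
  | ExecIIf a b p q s k s' :
      exec (if (ieval (ivar s) a < ieval (ivar s) b)%N then p else q) s k s' ->
      exec (IIf a b p q) s k s'
  | ExecIWhileEnd a b p s :
      (ieval (ivar s) b <= ieval (ivar s) a)%N -> exec (IWhile a b p) s 0 s
  | ExecIWhileStep a b p s1 s2 s3 k l :
      (ieval (ivar s1) a < ieval (ivar s1) b)%N ->
      exec p s1 k s2 -> exec (IWhile a b p) s2 l s3 ->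
      exec (IWhile a b p) s1 (k + l) s3
  | ExecRLit d k s : exec (RLit d k) s 0 (rset s (ieval (ivar s) d) k%:R)
  | ExecRCopy d a s :
      exec (RCopy d a) s 0
        (rset s (ieval (ivar s) d) (cell s (ieval (ivar s) a)))
  | ExecROp o d a b s :
      (o = OpDiv -> cell s (ieval (ivar s) b) != 0) ->
      exec (ROp o d a b) s 1
        (rset s (ieval (ivar s) d)
           (op_eval o (cell s (ieval (ivar s) a)) (cell s (ieval (ivar s) b))))
  | ExecRIf a b p q s k s' :
      exec (if cell s (ieval (ivar s) a) <= cell s (ieval (ivar s) b)
            then p else q) s k s' ->
      exec (RIf a b p q) s k.+1 s'.

(* The dimension [n] is in integer variable 0; the input (u.1, u.2) is in
   cells 0, 1, ..., n, and the output is read from the same cells. *)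
Definition input (R : realType) n (u : epoint R n) : state R :=
  State (upd (fun=> 0%N) 0 n)
    (fun j => if j is i.+1 then
                if insub i is Some i' then u.2 0 (i' : 'I_n) else 0
              else u.1).

Definition output (R : realType) n (s : state R) : epoint R n :=
  (cell s 0, \row_(i < n) cell s i.+1).

Definition computable_in_nlogn (R : realType)
    (f : forall n, epoint R n -> epoint R n) : Prop :=
  exists (p : prog) (T : nat -> nat),
    ((fun n => (T n)%:R : R^o) =O_\oo (fun n => n%:R * ln n%:R : R^o)) /\
    forall (n : nat) (u : epoint R n), (0 < n)%N ->
      exists (k : nat) (s : state R),
        [/\ exec p (input u) k s, (k <= T n)%N & output n s = f n u].

(* Main.v *)
Require Import Defs.
From mathcomp Require Import all_boot all_order all_algebra.
From mathcomp Require Import all_classical all_reals all_analysis.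
From mathcomp Require Import zify ring lra.
Import Order.TTheory GRing.Theory Num.Theory.
Import numFieldNormedType.Exports.
Local Open Scope classical_set_scope.
Local Open Scope ring_scope.

Set Implicit Arguments.
Unset Strict Implicit.

(** Write [u = (v, w)] and let [t] be the root of
   [t + v = sum_i max(w_i - t, 0)].  Then [q = (- t, min(w_i, t)_i)] lies in
   the polar cone, [u - q] lies in the cone, and the two are orthogonal, so by
   Moreau's decomposition they are the two projections of [u].  If [a] is [w]
   sorted in decreasing order, then [t = (a_0 + ... + a_(m-1) - v) / (m + 1)]
   for the first [m] at which this value is at least [a_m]; it is found by one
   pass over [a].  Sorting is by binary insertion: data movement is free in the
   machine model, so an insertion costs only the comparisons of its binary
   search. *)

(** * Euclidean geometry: nearest points and Moreau's decomposition *)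

Lemma dotC (R : realType) n (x y : 'rV[R]_n) : dot x y = dot y x.
Proof. by apply: eq_bigr => i _; rewrite mulrC. Qed.

Lemma dotDl (R : realType) n (x y z : 'rV[R]_n) :
  dot (x + y) z = dot x z + dot y z.
Proof.
by rewrite /dot -big_split; apply: eq_bigr => i _; rewrite mxE mulrDl.
Qed.

Lemma dotNl (R : realType) n (x z : 'rV[R]_n) : dot (- x) z = - dot x z.
Proof. by rewrite /dot -sumrN; apply: eq_bigr => i _; rewrite mxE mulNr. Qed.

Lemma dot_ge0 (R : realType) n (x : 'rV[R]_n) : 0 <= dot x x.
Proof. by apply: sumr_ge0 => i _; rewrite -expr2 sqr_ge0. Qed.

Lemma dot_eq0 (R : realType) n (x : 'rV[R]_n) : dot x x = 0 -> x = 0.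
Proof.
move=> /eqP; rewrite /dot psumr_eq0 => [/allP h|i _]; last first.
  by rewrite -expr2 sqr_ge0.
apply/rowP => i; rewrite mxE; apply/eqP; rewrite -sqrf_eq0 expr2.
by apply: h; rewrite mem_index_enum.
Qed.

Lemma innerC (R : realType) n (z w : epoint R n) : inner z w = inner w z.
Proof. by rewrite /inner dotC mulrC. Qed.

Lemma innerBl (R : realType) n (x y z : epoint R n) :
  inner (x - y) z = inner x z - inner y z.
Proof. by rewrite /inner /= dotDl dotNl; ring. Qed.

Lemma innerBr (R : realType) n (x y z : epoint R n) :
  inner z (x - y) = inner z x - inner z y.
Proof. by rewrite innerC innerBl !(innerC z). Qed.

Lemma inner_ge0 (R : realType) n (z : epoint R n) : 0 <= inner z z.
Proof. by rewrite addr_ge0 ?dot_ge0// -expr2 sqr_ge0. Qed.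

Lemma inner_eq0 (R : realType) n (z : epoint R n) : inner z z = 0 -> z = 0.
Proof.
case: z => a x /eqP; rewrite /inner /= -expr2 paddr_eq0 ?sqr_ge0 ?dot_ge0//.
by rewrite sqrf_eq0 => /andP[/eqP -> /eqP /dot_eq0 ->].
Qed.

Lemma enorm_le (R : realType) n (z w : epoint R n) :
  (enorm z <= enorm w) = (inner z z <= inner w w).
Proof. by rewrite /enorm ler_sqrt ?inner_ge0. Qed.

(** Expanding |p - u|^2 around [q] gives |p - q|^2 - 2 <u - q, p - q> + |q - u|^2. The middle term
    can only help [q], and the first one forces uniqueness. *)
Lemma nearest_point (R : realType) n (K : set (epoint R n)) (u q : epoint R n) :
  K q -> (forall p, K p -> inner (u - q) (p - q) <= 0) ->
  minimizers K (fun p => enorm (p - u)) = [set q].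
Proof.
move=> Kq varq.
have dist p : inner (p - u) (p - u) =
    inner (p - q) (p - q) - 2 * inner (u - q) (p - q) + inner (q - u) (q - u).
  rewrite !(innerBl, innerBr) (innerC u p) (innerC q p) (innerC q u); ring.
apply/seteqP; split => [p [Kp minp]|_ ->].
  have /inner_eq0/eqP : inner (p - q) (p - q) = 0.
    have := minp q Kq; rewrite enorm_le (dist p).
    by have := varq p Kp; have := inner_ge0 (p - q); lra.
  by rewrite subr_eq0 => /eqP.
split=> // p Kp; rewrite enorm_le (dist p).
by have := varq p Kp; have := inner_ge0 (p - q); lra.
Qed.

(** With u = p + q, the residual of [p] is [q] and conversely. By orthogonality both variational
    inequalities reduce to the sign condition that defines the polar cone. *)
Lemma moreau (R : realType) n (K : set (epoint R n)) (p q : epoint R n) :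
  K p -> polar K q -> inner q p = 0 ->
  minimizers K (fun z => enorm (z - (p + q))) = [set p] /\
  minimizers (polar K) (fun z => enorm (z - (p + q))) = [set q].
Proof.
move=> Kp Kq qp0; split; apply: nearest_point => // z Kz.
  by rewrite [p + q]addrC addrK innerBr qp0 subr0; exact: Kq.
by rewrite addrK innerBr (innerC p q) qp0 subr0 innerC; exact: Kz.
Qed.

Lemma orth_proj_eq (R : realType) n (K : set (epoint R n)) (u q : epoint R n) :
  minimizers K (fun p => enorm (p - u)) = [set q] -> orth_proj K u = q.
Proof.
move=> Kq; rewrite /orth_proj Kq; apply: xget_subset1 => //.
by move=> ? ? -> ->.
Qed.

(** * The cone over the simplex and its polar *)

Lemma simplex_delta (R : realType) n (i : 'I_n) :
  @simplex R n (delta_mx 0 i).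
Proof.
split=> [j|]; first by rewrite mxE ler0n.
rewrite (bigD1 i)//= mxE !eqxx big1 ?addr0// => j ji.
by rewrite mxE (negbTE ji) andbF.
Qed.

(** Testing against the vertices of the simplex gives the coordinate bounds. Conversely, a bound
    that holds at every vertex survives averaging with the weights [x]. *)
Lemma polar_simplex_cone (R : realType) n (y : epoint R n) :
  polar (@simplex_cone R n) y <-> forall i, y.2 0 i <= - y.1.
Proof.
split=> [ynp i|ymax _ [a a0 [[b x] [/= -> [x0 x1]] ->]]].
  have : @simplex_cone R n (1 * 1, 1 *: delta_mx 0 i).
    exists 1 => //; exists (1, delta_mx 0 i) => //; split=> //.
    exact: simplex_delta.
  move=> /ynp; rewrite /inner /= scale1r /dot (bigD1 i)//= big1 => [|j ji].
    by rewrite mxE !eqxx !mulr1 addr0 addrC -lerBrDr sub0r.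
  by rewrite mxE (negbTE ji) andbF mulr0.
rewrite /inner /= mulr1.
have -> : y.1 * a = \sum_(i < n) - ((- y.1) * (a * x 0 i)).
  by rewrite sumrN -!mulr_sumr x1; ring.
rewrite /dot -big_split /=; apply: sumr_le0 => i _.
rewrite mxE addrC subr_le0 ler_wpM2r// mulr_ge0//; exact: x0.
Qed.

Lemma max_feasibleE (R : realType) n :
  @max_feasible R n = polar (@simplex_cone R n).
Proof.
apply/seteqP; split=> y /=.
  move=> /bigmax_leP[_ yle]; apply/polar_simplex_cone => i.
  by rewrite -lee_fin yle.
move=> /polar_simplex_cone yle; apply/bigmax_leP; split; first exact: leNye.
by move=> i _; rewrite lee_fin.
Qed.

Lemma sq_objectiveE (R : realType) n (u y : epoint R n) :
  sq_objective u y = enorm (y - u) ^+ 2.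
Proof.
by rewrite /sq_objective /norm2 /enorm !sqr_sqrtr ?inner_ge0 ?dot_ge0.
Qed.

(** * The threshold equation and the two projections it determines *)

Definition threshold (R : realType) n (u : epoint R n) (t : R) : Prop :=
  t + u.1 = \sum_(i < n) Num.max (u.2 0 i - t) 0.

Definition cap (R : realType) n (u : epoint R n) (t : R) : epoint R n :=
  (- t, \row_i Num.min (u.2 0 i) t).

Definition excess (R : realType) n (u : epoint R n) (t : R) : epoint R n :=
  (u.1 + t, \row_i Num.max (u.2 0 i - t) 0).

Lemma excess_cap (R : realType) n (u : epoint R n) t : excess u t + cap u t = u.
Proof.
rewrite {3}[u]surjective_pairing; congr pair; first by rewrite /= addrK.
apply/rowP => i; rewrite !mxE.
by case: (leP (u.2 0 i) t); case: (leP (u.2 0 i - t) 0); lra.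
Qed.

(** The threshold equation says that the entries of the vector part sum to the scalar part, so
    dividing by the latter gives a point of the simplex. If this sum vanishes, the excess is zero,
    that is, 0 times any vertex; [0 < n] provides one. *)
Lemma simplex_cone_excess (R : realType) n (u : epoint R n) t :
  (0 < n)%N -> threshold u t -> simplex_cone (excess u t).
Proof.
move=> n0 ut.
have pos i : 0 <= Num.max (u.2 0 i - t) 0 by rewrite le_max lexx orbT.
have : 0 <= \sum_(i < n) Num.max (u.2 0 i - t) 0 by apply: sumr_ge0.
rewrite -ut addrC le_eqVlt => /orP[/eqP a0|a_gt0].
  have zero i : Num.max (u.2 0 i - t) 0 = 0.
    apply/eqP; have /esym/eqP : 0 = \sum_(i < n) Num.max (u.2 0 i - t) 0.
      by rewrite -ut addrC.
    by rewrite psumr_eq0// => /allP/(_ i); apply; rewrite mem_index_enum.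
  exists 0 => //; exists (1, delta_mx 0 (Ordinal n0)).
    by split=> //; exact: simplex_delta.
  rewrite /excess -a0 mul0r scale0r; congr pair.
  by apply/rowP => i; rewrite !mxE zero.
exists (u.1 + t); first exact: ltW.
exists (1, (u.1 + t)^-1 *: (excess u t).2).
  split=> //; split=> [i|]; rewrite /=.
    by rewrite !mxE mulr_ge0// invr_ge0 ltW.
  under eq_bigr do rewrite !mxE.
  by rewrite -mulr_sumr -ut (addrC t) mulVf// gt_eqF.
by rewrite /= mulr1 scalerA divff ?gt_eqF// scale1r.
Qed.

Lemma polar_cap (R : realType) n (u : epoint R n) t :
  polar (@simplex_cone R n) (cap u t).
Proof.
by apply/polar_simplex_cone => i; rewrite /= mxE opprK ge_min lexx orbT.
Qed.

(** Wherever max(w_i - t, 0) is nonzero, min(w_i, t) equals t. The vector parts thus contribute t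
    times the sum of the excesses, which the threshold equation cancels against the scalar parts. *)
Lemma inner_cap_excess (R : realType) n (u : epoint R n) t :
  threshold u t -> inner (cap u t) (excess u t) = 0.
Proof.
move=> ut; rewrite /inner /= addrC (addrC u.1) ut mulNr mulr_sumr.
apply/eqP; rewrite subr_eq0; apply/eqP/eq_bigr => i _; rewrite !mxE.
by case: (leP (u.2 0 i) t); case: (leP (u.2 0 i - t) 0); nra.
Qed.

Lemma minimizers_threshold (R : realType) n (u : epoint R n) t :
  (0 < n)%N -> threshold u t ->
  minimizers (@simplex_cone R n) (fun z => enorm (z - u)) = [set excess u t] /\
  minimizers (polar (@simplex_cone R n)) (fun z => enorm (z - u))
    = [set cap u t].
Proof.
move=> n0 ut; rewrite -{1 3}(excess_cap u t); apply: moreau.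
- exact: simplex_cone_excess.
- exact: polar_cap.
- exact: inner_cap_excess.
Qed.

(** * Total correctness rules with cost bounds *)

Definition runs (R : realType) (p : prog) (s : state R) (K : nat)
    (Q : state R -> Prop) : Prop :=
  exists k s', [/\ exec p s k s', (k <= K)%N & Q s'].

Lemma runs_weaken (R : realType) p (s : state R) K K' (Q Q' : state R -> Prop) :
  runs p s K Q -> (K <= K')%N -> (forall s', Q s' -> Q' s') -> runs p s K' Q'.
Proof.
move=> [k [s' [es kK Qs']]] KK' QQ'; exists k, s'.
by split=> //; [exact: leq_trans KK' | exact: QQ'].
Qed.

Lemma runs_skip (R : realType) (s : state R) K (Q : state R -> Prop) :
  Q s -> runs Skip s K Q.
Proof. by exists 0%N, s; split=> //; exact: ExecSkip. Qed.

(** The run of [q] is the postcondition of [p], so that a program is verified by stepping forward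
    through its instructions. *)
Lemma runs_seq (R : realType) K1 K2 p q (s : state R) (Q : state R -> Prop) :
  runs p s K1 (fun s' => runs q s' K2 Q) -> runs (Seq p q) s (K1 + K2) Q.
Proof.
move=> [k [s1 [e1 kK1 [l [s2 [e2 lK2 Qs2]]]]]].
by exists (k + l)%N, s2; split=> //; [exact: ExecSeq e1 e2 | exact: leq_add].
Qed.

Lemma runs_iset (R : realType) x a (s : state R) K (Q : state R -> Prop) :
  Q (iset s x (ieval (ivar s) a)) -> runs (ISet x a) s K Q.
Proof.
by move=> Qs; exists 0%N; eexists; split; [exact: ExecISet|by []|exact: Qs].
Qed.

Lemma runs_rlit (R : realType) d m (s : state R) K (Q : state R -> Prop) :
  Q (rset s (ieval (ivar s) d) m%:R) -> runs (RLit d m) s K Q.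
Proof.
by move=> Qs; exists 0%N; eexists; split; [exact: ExecRLit|by []|exact: Qs].
Qed.

Lemma runs_rcopy (R : realType) d a (s : state R) K (Q : state R -> Prop) :
  Q (rset s (ieval (ivar s) d) (cell s (ieval (ivar s) a))) ->
  runs (RCopy d a) s K Q.
Proof.
by move=> Qs; exists 0%N; eexists; split; [exact: ExecRCopy|by []|exact: Qs].
Qed.

Lemma runs_rop (R : realType) o d a b (s : state R) K (Q : state R -> Prop) :
  (o = OpDiv -> cell s (ieval (ivar s) b) != 0) ->
  Q (rset s (ieval (ivar s) d)
       (op_eval o (cell s (ieval (ivar s) a)) (cell s (ieval (ivar s) b)))) ->
  runs (ROp o d a b) s K.+1 Q.
Proof.
by move=> b0 Qs; exists 1%N; eexists; split; [exact: ExecROp|by []|exact: Qs].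
Qed.

Lemma runs_rif (R : realType) a b p q (s : state R) K (Q : state R -> Prop) :
  (cell s (ieval (ivar s) a) <= cell s (ieval (ivar s) b) -> runs p s K Q) ->
  (cell s (ieval (ivar s) b) < cell s (ieval (ivar s) a) -> runs q s K Q) ->
  runs (RIf a b p q) s K.+1 Q.
Proof.
move=> rp rq.
suff [k [s' [es kK Qs']]] : runs (if cell s (ieval (ivar s) a)
    <= cell s (ieval (ivar s) b) then p else q) s K Q.
  by exists k.+1, s'; split=> //; exact: ExecRIf.
by case: leP.
Qed.

(* [j] is only an upper bound on the number of remaining iterations. *)
Lemma runs_while (R : realType) a b p c (I : nat -> state R -> Prop)
    (Q : state R -> Prop) :
  (forall j s, I j s -> (ieval (ivar s) a < ieval (ivar s) b)%N ->
     exists2 j', (j' < j)%N & runs p s c (I j')) ->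
  (forall j s, I j s -> (ieval (ivar s) b <= ieval (ivar s) a)%N -> Q s) ->
  forall j s, I j s -> runs (IWhile a b p) s (j * c) Q.
Proof.
move=> step stop j; have [m jm] := ubnP j; elim: m j jm => // m IHm j jm s Is.
case: (leqP (ieval (ivar s) b) (ieval (ivar s) a)) => ab.
  exists 0%N, s; split=> //; first exact: ExecIWhileEnd.
  exact: stop Is ab.
have [j' j'j [k [s1 [e1 kc Is1]]]] := step _ _ Is ab.
have [|l [s2 [e2 lc Qs2]]] := IHm j' _ _ Is1; first by lia.
exists (k + l)%N, s2; split=> //; first exact: ExecIWhileStep e1 e2.
by rewrite (leq_trans (leq_add kc lc))// -mulSn leq_mul2r j'j orbT.
Qed.

Definition iincr (a : iexp) : iexp := IAdd a (INum 1).

Definition for_loop (p : prog) : prog :=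
  Seq (ISet 1 (INum 0))
      (IWhile (IVar 1) (IVar 0) (Seq p (ISet 1 (iincr (IVar 1))))).

(** The invariant mentions only cells. The body may change any integer variable except the dimension
    (0) and the counter (1), whose values it must preserve. *)
Lemma runs_for (R : realType) n p c (I : nat -> (nat -> R) -> Prop) :
  (forall i s, (i < n)%N -> ivar s 0 = n -> ivar s 1 = i -> I i (cell s) ->
     runs p s c (fun s' =>
       [/\ ivar s' 0 = n, ivar s' 1 = i & I i.+1 (cell s')])) ->
  forall s, ivar s 0 = n -> I 0%N (cell s) ->
  runs (for_loop p) s (n * c) (fun s' => ivar s' 0 = n /\ I n (cell s')).
Proof.
move=> step s sn I0; apply: (@runs_seq _ 0); apply: runs_iset.
pose J j (s : state R) := [/\ ivar s 0 = n, (ivar s 1 <= n)%N,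
  j = (n - ivar s 1)%N & I (ivar s 1) (cell s)].
apply: (@runs_while _ _ _ _ _ J); last by split=> //=; rewrite subn0.
- move=> j s1 [s1n le_n -> Is] /= lt_n; rewrite s1n in lt_n.
  exists (n - (ivar s1 1).+1)%N; first by lia.
  rewrite -[c]addn0; apply: runs_seq.
  apply: (runs_weaken (step _ _ lt_n s1n erefl Is)) => // s' [sn' si' Is'].
  by apply: runs_iset; rewrite /J /= /upd /= si' addn1.
- move=> j s1 [s1n le_n _ Is] /= ge_n; split=> //; rewrite s1n in ge_n.
  by have <- : ivar s1 1%N = n by lia.
Qed.

(** * Binary insertion sort, in decreasing order *)

(* Cells [n + 1], ..., [2 n] hold the array being sorted. *)
Definition slot (a : iexp) : iexp := IAdd (iincr (IVar 0)) a.

Definition imid : iexp := IDiv (IAdd (IVar 2) (IVar 3)) (INum 2).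

(** The insertion point lies between variables 2 and 3. The key is cell i + 1, where i is variable
    1; it will be placed in front of the entries equal to it. *)
Definition binary_search : prog :=
  Seq (ISet 2 (INum 0)) (Seq (ISet 3 (IVar 1))
    (IWhile (IVar 2) (IVar 3)
      (RIf (slot imid) (iincr (IVar 1))
         (ISet 3 imid) (ISet 2 (iincr imid))))).

(** Variable 3 descends from the end of the prefix, so that each entry is copied upwards before its
    own cell is overwritten. *)
Definition shift : prog :=
  Seq (ISet 3 (IVar 1))
    (Seq (IWhile (IVar 2) (IVar 3)
       (Seq (RCopy (slot (IVar 3)) (slot (ISub (IVar 3) (INum 1))))
            (ISet 3 (ISub (IVar 3) (INum 1)))))
     (RCopy (slot (IVar 2)) (iincr (IVar 1)))).

Lemma runs_binary_search (R : realType) n i (s : state R) :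
  ivar s 0 = n -> ivar s 1 = i -> (i < n)%N ->
  {in gtn i &, forall j k, (j <= k)%N ->
     cell s (n + 1 + k) <= cell s (n + 1 + j)} ->
  runs binary_search s (trunc_log 2 n).+1 (fun s' =>
    [/\ cell s' = cell s, ivar s' 0 = n, ivar s' 1 = i, (ivar s' 2 <= i)%N &
     (forall j, (j < ivar s' 2)%N -> cell s (i + 1) < cell s (n + 1 + j)) /\
     (forall j, (ivar s' 2 <= j < i)%N ->
       cell s (n + 1 + j) <= cell s (i + 1))]).
Proof.
move=> sn si lt_in sorted.
apply: (@runs_seq _ 0); apply: runs_iset; apply: (@runs_seq _ 0).
apply: runs_iset.
(* Here [c] bounds the comparisons still to come: the interval has length below 2^c, and each
   comparison at least halves it. Initially its length is i < n < 2^([trunc_log 2 n] + 1). *)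
pose J c (s' : state R) := [/\ cell s' = cell s, ivar s' 0 = n, ivar s' 1 = i,
  (ivar s' 2 <= ivar s' 3 <= i)%N & [/\ (ivar s' 3 - ivar s' 2 < 2 ^ c)%N,
     (forall j, (j < ivar s' 2)%N -> cell s (i + 1) < cell s (n + 1 + j)) &
     (forall j, (ivar s' 3 <= j < i)%N ->
       cell s (n + 1 + j) <= cell s (i + 1))]].
rewrite -[(trunc_log 2 n).+1]muln1; apply: (@runs_while _ _ _ _ _ J).
- move=> c s' [cs sn' si' /andP[lh hi] [szc lo_gt hi_le]] /= lt_lh.
  case: c szc => [|c] szc; first by lia.
  exists c => //; rewrite expnS in szc.
  set mid := ((ivar s' 2 + ivar s' 3) %/ 2)%N.
  have mid_lo : (ivar s' 2 <= mid)%N by rewrite /mid; lia.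
  have mid_hi : (mid < ivar s' 3)%N by rewrite /mid; lia.
  apply: runs_rif => /=; rewrite -/mid cs sn' si' => cmp; apply: runs_iset;
    rewrite /J /= /upd /= -/mid.
    split=> //; first by lia.
    split=> // [|j jm]; first by lia.
    have : cell s (n + 1 + j) <= cell s (n + 1 + mid).
      by apply: sorted; rewrite ?inE /gtn /=; lia.
    by move=> /le_trans; apply.
  split=> //; first by lia.
  split=> // [|j jm]; first by lia.
  have : cell s (n + 1 + mid) <= cell s (n + 1 + j).
    by apply: sorted; rewrite ?inE /gtn /=; lia.
  exact: lt_le_trans.
- move=> c s' [cs sn' si' lh [szc lo_gt hi_le]] /= ge_lh.
  split=> //; first by lia.
  by split=> // j jr; apply: hi_le; lia.
rewrite /J /= /upd /=; split=> //; first by rewrite si leqnn.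
split=> [|j|j]; [|lia|by rewrite si; lia].
by rewrite subn0 si (leq_trans lt_in)// ltnW// trunc_log_ltn.
Qed.

Definition inserted (T : Type) (x : T) n p i (c : nat -> T) : nat -> T :=
  fun k => if k == (n + 1 + p)%N then x
           else if (n + 1 + p < k <= n + 1 + i)%N then c (k - 1)%N else c k.

Lemma runs_shift (R : realType) n i p (s : state R) :
  ivar s 0 = n -> ivar s 1 = i -> ivar s 2 = p -> (p <= i < n)%N ->
  runs shift s 0 (fun s' => [/\ ivar s' 0 = n, ivar s' 1 = i &
    cell s' =1 inserted (cell s (i + 1)) n p i (cell s)]).
Proof.
move=> sn si sp /andP[pi lt_in].
apply: (@runs_seq _ 0 0); apply: runs_iset; apply: (@runs_seq _ 0 0).
pose J d (s' : state R) := [/\ ivar s' 0 = n, ivar s' 1 = i, ivar s' 2 = p,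
  (p <= ivar s' 3 <= i)%N /\ d = (ivar s' 3 - p)%N &
  forall k, cell s' k = if (n + 1 + ivar s' 3 < k <= n + 1 + i)%N
                        then cell s (k - 1) else cell s k].
(* Copies are free; the zero budget is written as a product to fit [runs_while], with i - p
   iterations of cost 0. *)
apply: (@runs_weaken _ _ _ ((i - p) * 0)); last 2 first.
- by rewrite muln0.
- by move=> s'; apply.
apply: (@runs_while _ _ _ _ _ J).
- move=> d s' [sn' si' sp' [lej ->] cs] /= lt_pj; rewrite sp' in lt_pj.
  exists (ivar s' 3 - p).-1; first by lia.
  apply: (@runs_seq _ 0 0); apply: runs_rcopy; apply: runs_iset.
  rewrite /J /=; set c' := upd (cell s') _ _; rewrite /upd /=.
  split=> //; first by lia.
  move=> k; rewrite /c' /upd sn' /=.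
  case: eqP => [->|k_neq].
    by rewrite cs ifF ?ifT; [congr (cell s _)|..]; lia.
  by rewrite cs; congr (if _ then _ else _); lia.
- move=> d s' [sn' si' sp' [lej _] cs] /= ge_pj; rewrite sp' in ge_pj.
  apply: runs_rcopy; rewrite /= sn' si' sp'; split=> // k.
  rewrite /upd /inserted; case: eqP => // k_neq; rewrite cs.
    by rewrite ifF//; lia.
  by have -> : ivar s' 3 = p by lia.
- rewrite /J /= /upd /=; split=> //; first by lia.
  by move=> k; rewrite ifF//; lia.
Qed.

(* The sums over all [f] say that the sorted array is a permutation of
   [u 1], ..., [u i]. *)
Definition insertion_inv (R : realType) n (u : nat -> R) i (c : nat -> R) :
    Prop :=
  [/\ forall k, (k <= n)%N -> c k = u k,
      {in gtn i &, forall j k, (j <= k)%N -> c (n + 1 + k)%N <= c (n + 1 + j)%N}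
    & forall f : R -> R, \sum_(0 <= j < i) f (c (n + 1 + j)%N)
                         = \sum_(0 <= j < i) f (u (j + 1)%N)].

(** Entries before [p] are untouched and exceed the key, and those after it are shifted by one and
    do not. Order then follows by locating both indices relative to [p], and the sums agree after
    splitting at [p]. *)
Lemma inserted_inv (R : realType) n (u : nat -> R) i p (c c' : nat -> R) :
  (p <= i < n)%N -> insertion_inv n u i c ->
  (forall j, (j < p)%N -> c (i + 1)%N < c (n + 1 + j)%N) ->
  (forall j, (p <= j < i)%N -> c (n + 1 + j)%N <= c (i + 1)%N) ->
  c' =1 inserted (c (i + 1)%N) n p i c ->
  insertion_inv n u i.+1 c'.
Proof.
move=> /andP[pi lt_in] [cu sorted sums] gtx lex c'E.
have c'_lt j : (j < p)%N -> c' (n + 1 + j)%N = c (n + 1 + j)%N.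
  by move=> jp; rewrite c'E /inserted !ifF//; lia.
have c'_eq : c' (n + 1 + p)%N = c (i + 1)%N by rewrite c'E /inserted eqxx.
have c'_gt j : (p <= j < i)%N -> c' (n + 1 + j.+1)%N = c (n + 1 + j)%N.
  move=> jp; rewrite c'E /inserted ifF ?ifT; [|lia|lia].
  by congr c; lia.
split=> [k kn|j k|f].
- by rewrite c'E /inserted !ifF ?cu//; lia.
- rewrite !inE /gtn /= => ji ki jk.
  have srt a b : (a <= b < i)%N -> c (n + 1 + b)%N <= c (n + 1 + a)%N.
    by move=> ab; apply: sorted; rewrite ?inE /gtn /=; lia.
  have [jp|pj|jp] := ltngtP j p; have [kp|pk|kp] := ltngtP k p; try lia.
  + by rewrite !c'_lt//; apply: srt; lia.
  + case: k => // k in ki jk pk *.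
    by rewrite (c'_lt j)// c'_gt; [apply: srt|]; lia.
  + by rewrite kp c'_eq c'_lt// ltW// gtx.
  + case: j k => [//|j] [//|k] in ji ki jk pj pk *.
    by rewrite !c'_gt; [apply: srt|..]; lia.
  + case: k => // k in ki jk pk *.
    by rewrite jp c'_eq c'_gt; [apply: lex|]; lia.
  + by rewrite jp kp.
- rewrite (@big_cat_nat _ _ _ p)//=; last by lia.
  rewrite [X in _ + X]big_nat_recl//.
  rewrite (@eq_big_nat _ _ _ 0 p _ (fun j => f (c (n + 1 + j)%N))); last first.
    by move=> j /andP[_ jp]; rewrite c'_lt.
  rewrite (@eq_big_nat _ _ _ p i _ (fun j => f (c (n + 1 + j)%N))); last first.
    by move=> j jp; rewrite c'_gt.
  rewrite big_nat_recr//= -sums (@big_cat_nat _ _ _ p 0 i)//= c'_eq.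
  rewrite cu; last by lia.
  by rewrite -addrA (addrC (f _)).
Qed.

Definition insertion_sort : prog := for_loop (Seq binary_search shift).

Lemma runs_insertion_sort (R : realType) n (s : state R) :
  ivar s 0 = n ->
  runs insertion_sort s (n * (trunc_log 2 n).+1)
    (fun s' => ivar s' 0 = n /\ insertion_inv n (cell s) n (cell s')).
Proof.
move=> sn; apply: runs_for => //; last first.
  by split=> // f; rewrite !big_geq.
move=> i s1 lt_in s1n s1i inv; rewrite -[(trunc_log 2 n).+1]addn0.
have [_ sorted _] := inv.
apply: runs_seq.
apply: (runs_weaken (runs_binary_search s1n s1i lt_in sorted)) => //.
move=> s2 [c2 s2n s2i le_pi [gtx lex]].
apply: (runs_weaken (runs_shift s2n s2i erefl _)) => //; first by lia.
move=> s3 [s3n s3i c3]; split=> //; rewrite c2 in c3.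
by apply: inserted_inv inv gtx lex c3; lia.
Qed.

(** * One pass over the sorted array to find the threshold *)

(* Cell [2 n + k] holds, for [k = 1, 2, 3, 4]: the sum of the [m] entries
   selected so far minus [u.1], the real number [m + 1], the constant [1], and
   the quotient of the first two, which ends up as the threshold. *)
Definition aux (k : nat) : iexp := IAdd (IMul (INum 2) (IVar 0)) (INum k).

(** The start is m = 0 with t = - u.1; the cell of t first serves as a zero for this negation. The
    pass never stops early: after one entry is rejected, all later ones are rejected too. *)
Definition scan : prog :=
  Seq (RLit (aux 4) 0) (Seq (RLit (aux 2) 1) (Seq (RLit (aux 3) 1)
  (Seq (ROp OpSub (aux 1) (aux 4) (INum 0)) (Seq (RCopy (aux 4) (aux 1))
  (for_loop (RIf (slot (IVar 1)) (aux 4) Skip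
     (Seq (ROp OpAdd (aux 1) (aux 1) (slot (IVar 1)))
     (Seq (ROp OpAdd (aux 2) (aux 2) (aux 3))
          (ROp OpDiv (aux 4) (aux 1) (aux 2)))))))))).

Definition scan_inv (R : realType) n (a : nat -> R) (u0 : R) i (c : nat -> R) :
    Prop :=
  exists2 m, (m <= i)%N &
  [/\ forall j, (j < m)%N -> c (2 * n + 4)%N < a j,
      forall j, (m <= j < i)%N -> a j <= c (2 * n + 4)%N,
      c (2 * n + 1)%N = \sum_(0 <= j < m) a j - u0,
      c (2 * n + 2)%N = m.+1%:R
    & c (2 * n + 3)%N = 1 /\ c (2 * n + 4)%N = c (2 * n + 1)%N / m.+1%:R].

(** Exactly the first [m] entries exceed t, so the sum of the positive parts is their sum minus m t.
    With (m + 1) t equal to that sum minus [u0], this is the threshold equation. *)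
Lemma scan_inv_threshold (R : realType) n (a : nat -> R) u0 (c : nat -> R) :
  scan_inv n a u0 n c ->
  c (2 * n + 4)%N + u0
    = \sum_(0 <= j < n) Num.max (a j - c (2 * n + 4)%N) 0.
Proof.
move=> [m mn [gtt let_ cS _ [_ tE]]]; set t := c _ in gtt let_ tE *.
rewrite (@big_cat_nat _ _ _ m)//=.
rewrite [X in _ = _ + X]big1_seq ?addr0 => [|j]; last first.
  rewrite mem_index_iota => /andP[_ jm]; apply/max_idPr.
  by rewrite subr_le0 let_.
rewrite (@eq_big_nat _ _ _ 0 m _ (fun j => a j - t)); last first.
  move=> j /andP[_ jm]; apply/max_idPl.
  by rewrite subr_ge0 ltW// gtt.
rewrite sumrB sumr_const_nat subn0 -[\sum_(_ <= _ < _) _](subrK u0) -cS.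
have -> : c (2 * n + 1)%N = t * m.+1%:R by rewrite tE mulfVK.
by rewrite -[t *+ m]mulr_natr -natr1; ring.
Qed.

(** The new threshold is ((m + 1) t + a_i) / (m + 2), a weighted mean of t and a_i. Since t < a_i it
    stays below a_i, hence below all entries selected earlier. *)
Lemma scan_inv_step (R : realType) n (a : nat -> R) u0 i (c c' : nat -> R) :
  (forall j k, (j <= k <= i)%N -> a k <= a j) ->
  scan_inv n a u0 i c -> c (2 * n + 4)%N < a i ->
  c' (2 * n + 1)%N = c (2 * n + 1)%N + a i ->
  c' (2 * n + 2)%N = c (2 * n + 2)%N + c (2 * n + 3)%N ->
  c' (2 * n + 3)%N = c (2 * n + 3)%N ->
  c' (2 * n + 4)%N = c' (2 * n + 1)%N / c' (2 * n + 2)%N ->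
  scan_inv n a u0 i.+1 c'.
Proof.
move=> sorted [m mi [gtt let_ cS cm [c1 tE]]] tai c'S c'm c'1 c't.
(* No entry has been rejected so far: otherwise a_m <= t < a_i, against the decreasing order. *)
have {}mi : m = i.
  apply/eqP; rewrite eqn_leq mi /= leqNgt; apply/negP => lt_mi.
  have : a i <= a m by apply: sorted; lia.
  by move=> /(lt_le_trans tai); rewrite ltNge let_// leqnn.
subst m; exists i.+1 => //; rewrite c'1 c1 c't c'm c1 cm natr1.
have c'S' : c' (2 * n + 1)%N = c (2 * n + 4)%N * i.+1%:R + a i.
  by rewrite c'S tE mulfVK.
split=> //; first 2 last.
- by rewrite c'S cS big_nat_recr//=; ring.
- move=> j ji; have : a i <= a j by apply: sorted; lia.
  apply: lt_le_trans; rewrite ltr_pdivrMr// c'S' -[i.+2%:R]natr1 mulrDr mulr1.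
  by rewrite ltrD2r ltr_pM2r.
- by move=> j /andP[]; lia.
Qed.

(** One subtraction initialises the scan; an entry costs at most a comparison, two additions and a
    division. Only cells above 2 n are written, so input and sorted array stay intact. *)
Lemma runs_scan (R : realType) n (s : state R) :
  ivar s 0 = n ->
  (forall j k, (j <= k < n)%N -> cell s (n + 1 + k) <= cell s (n + 1 + j)) ->
  runs scan s (1 + n * 4) (fun s' =>
    [/\ ivar s' 0 = n, forall j, (j <= n)%N -> cell s' j = cell s j &
      cell s' (2 * n + 4)%N + cell s 0%N
      = \sum_(0 <= j < n)
          Num.max (cell s (n + 1 + j) - cell s' (2 * n + 4)%N) 0]).
Proof.
move=> sn sorted.
pose a j := cell s (n + 1 + j)%N.
pose I i c := (forall j, (j <= 2 * n)%N -> c j = cell s j) /\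
  scan_inv n a (cell s 0%N) i c.
do 3!(apply: (@runs_seq _ 0); apply: runs_rlit).
apply: (@runs_seq _ 1); apply: runs_rop => //.
apply: (@runs_seq _ 0); apply: runs_rcopy.
apply: (@runs_weaken _ _ _ (n * 4) _
  (fun s' => ivar s' 0 = n /\ I n (cell s'))).
- apply: runs_for => //=; last first.
    rewrite sn; split=> [j jn|]; first by rewrite /upd !ifF//; lia.
    exists 0%N => //; split=> //; try by move=> j; lia.
    + by rewrite /upd !eqn_add2l/= big_geq// !ifF ?sub0r//; lia.
    + by rewrite /upd !eqn_add2l.
    + by rewrite /upd !eqn_add2l/= divr1 ifF//; lia.
  move=> i s1 lt_in s1n s1i [frame inv]; apply: runs_rif => /= cmp.
    apply: runs_skip; split=> //; split=> //.
    rewrite s1n s1i frame in cmp; last by lia.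
    have [m mi [gtt let_ cS cm cte]] := inv.
    exists m; first by lia.
    split=> // j jm; have [ji|ji] := ltnP j i; first by apply: let_; lia.
    by have -> : j = i by lia.
  rewrite s1n s1i (frame (n + 1 + i)%N) in cmp; last by lia.
  have srt j k : (j <= k <= i)%N -> a k <= a j by move=> jk; apply: sorted; lia.
  have [m mi [_ _ _ cm [c1 _]]] := inv.
  apply: (@runs_seq _ 1); apply: runs_rop => //.
  apply: (@runs_seq _ 1); apply: runs_rop => //.
  apply: runs_rop => /=.
    move=> _; rewrite s1n /upd !eqn_add2l/= cm c1 natr1.
    by rewrite pnatr_eq0.
  split=> //; rewrite /= s1n s1i; split=> [j jn|].
    by rewrite /upd !ifF ?frame//; lia.
  apply: scan_inv_step srt inv cmp _ _ _ _; rewrite /upd !eqn_add2l//=.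
  by rewrite (frame (n + 1 + i)%N)//; lia.
- exact: leqnn.
- move=> s' [s'n [frame inv]]; split=> //.
    by move=> j jn; apply: frame; lia.
  exact: scan_inv_threshold inv.
Qed.

(** * The two projection programs *)

Definition find_threshold : prog := Seq insertion_sort scan.

Lemma runs_find_threshold (R : realType) n (u : epoint R n) :
  runs find_threshold (input u) (n * (trunc_log 2 n).+1 + (1 + n * 4))
    (fun s => [/\ ivar s 0 = n, cell s 0%N = u.1,
       forall i : 'I_n, cell s i.+1 = u.2 0 i &
       threshold u (cell s (2 * n + 4)%N)]).
Proof.
have inN : ivar (input u) 0 = n by [].
apply: runs_seq; apply: (runs_weaken (runs_insertion_sort inN)) => // s1.
move=> [s1n [frame sorted sums]].
apply: (runs_weaken (runs_scan s1n _)) => //.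
  by move=> j k jk; apply: sorted; rewrite ?inE /gtn /=; lia.
have inputE (i : 'I_n) : cell (input u) i.+1 = u.2 0 i by rewrite /= valK.
move=> s2 [s2n frame2 tE]; split=> //.
- by rewrite frame2// frame.
- by move=> i; rewrite frame2 ?frame ?inputE//; exact: ltn_ord.
- rewrite /threshold; rewrite frame// in tE; rewrite tE.
  (* The permutation property, applied to the positive part of x - t, carries the equation from the
     sorted array back to [u]. *)
  rewrite (sums (fun x => Num.max (x - cell s2 (2 * n + 4)%N) 0)) big_mkord.
  by apply: eq_bigr => i _; rewrite addn1 inputE.
Qed.

Definition project_polar : prog :=
  Seq find_threshold
    (Seq (for_loop (RIf (iincr (IVar 1)) (aux 4) Skip
                        (RCopy (iincr (IVar 1)) (aux 4))))
         (Seq (RLit (aux 1) 0) (ROp OpSub (INum 0) (aux 1) (aux 4)))).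

Definition project_cone : prog :=
  Seq find_threshold
    (Seq (for_loop (RIf (iincr (IVar 1)) (aux 4) (RLit (iincr (IVar 1)) 0)
                        (ROp OpSub (iincr (IVar 1)) (iincr (IVar 1)) (aux 4))))
         (ROp OpAdd (INum 0) (INum 0) (aux 4))).

(** Each iteration writes only its own cell i + 1, so it reads an original entry; the threshold cell
    2 n + 4 is out of reach. *)
Lemma runs_map (R : realType) n (p : prog) (g : R -> R -> R) (s : state R) :
  (forall i s, (i < n)%N -> ivar s 0 = n -> ivar s 1 = i ->
     runs p s 2 (fun s' => ivar s' = ivar s /\
       cell s' =1 upd (cell s) i.+1
         (g (cell s i.+1) (cell s (2 * n + 4)%N)))) ->
  ivar s 0 = n ->
  runs (for_loop p) s (n * 2) (fun s' => ivar s' 0 = n /\ forall j, cell s' j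
    = if (0 < j <= n)%N then g (cell s j) (cell s (2 * n + 4)%N) else cell s j).
Proof.
move=> step sn; apply: (runs_for (I := fun i c => forall j, c j
    = if (0 < j <= i)%N then g (cell s j) (cell s (2 * n + 4)%N)
      else cell s j)) => //; last first.
  by move=> j; rewrite ifF//; lia.
move=> i s1 lt_in s1n s1i inv.
apply: (runs_weaken (step _ _ lt_in s1n s1i)) => // s2 [-> c2]; split=> // j.
rewrite c2 /upd !inv; case: eqP => [->|ji].
  by rewrite ltnn leqnn /= ifF//; lia.
by congr (if _ then _ else _); lia.
Qed.

Lemma runs_project_polar (R : realType) n (u : epoint R n) :
  runs project_polar (input u)
    (n * (trunc_log 2 n).+1 + (1 + n * 4) + (n * 2 + 1))
    (fun s => exists2 t, threshold u t & output n s = cap u t).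
Proof.
apply: runs_seq; apply: (runs_weaken (runs_find_threshold u)) => //.
move=> s1 [s1n _ s1u ut]; apply: runs_seq.
apply: (runs_weaken (runs_map (g := Num.min) _ s1n)) => //.
  move=> i s lt_in sn si; apply: runs_rif => /=; rewrite sn si addn1 => cmp.
    apply: runs_skip; split=> // j; rewrite /upd; case: eqP => // ->.
    by rewrite min_l.
  by apply: runs_rcopy; split=> // j; rewrite /= sn si addn1 min_r// ltW.
move=> s2 [s2n c2].
apply: (@runs_seq _ 0 1); apply: runs_rlit; apply: runs_rop => //.
exists (cell s1 (2 * n + 4)%N) => //; rewrite /output /cap /= s2n; congr pair.
  by rewrite /upd !eqn_add2l/= sub0r c2 ifF//; lia.
apply/rowP => i; rewrite !mxE /upd /= ifF; last by have := ltn_ord i; lia.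
by rewrite c2 ifT ?s1u//; exact: ltn_ord.
Qed.

Lemma runs_project_cone (R : realType) n (u : epoint R n) :
  runs project_cone (input u)
    (n * (trunc_log 2 n).+1 + (1 + n * 4) + (n * 2 + 1))
    (fun s => exists2 t, threshold u t & output n s = excess u t).
Proof.
apply: runs_seq; apply: (runs_weaken (runs_find_threshold u)) => //.
move=> s1 [s1n s1u0 s1u ut]; apply: runs_seq.
apply: (runs_weaken (runs_map (g := fun x t => Num.max (x - t) 0) _ s1n)) => //.
  move=> i s lt_in sn si; apply: runs_rif => /=; rewrite sn si addn1 => cmp.
    by apply: runs_rlit; split=> // j; rewrite /= si addn1 max_r ?subr_le0.
  apply: runs_rop => //; split=> // j.
  by rewrite /= sn si addn1 max_l ?subr_ge0 ?ltW.
move=> s2 [s2n c2]; apply: runs_rop => //.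
exists (cell s1 (2 * n + 4)%N) => //; rewrite /output /excess /= s2n.
congr pair.
  by rewrite /upd /= !c2 /= s1u0 ifF//; lia.
by apply/rowP => i; rewrite !mxE /upd /= c2 ifT ?s1u//; exact: ltn_ord.
Qed.

(** * Asymptotic cost and conclusion *)

Definition cost_bound (n : nat) : nat :=
  n * (trunc_log 2 n).+1 + (1 + n * 4) + (n * 2 + 1).

Lemma cost_bound_nlogn (R : realType) :
  (fun n => (cost_bound n)%:R : R^o) =O_\oo (fun n => n%:R * ln n%:R : R^o).
Proof.
have ln2 : 0 < ln (2 : R) by rewrite ln_gt0// ltr1n.
(* Let L = [trunc_log 2 n]. For n >= 2 one has L >= 1, so the cost n L + 7 n + 2 is at most 11 n L,
   with room to spare; 2^L <= n then gives L <= ln n / ln 2. *)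
apply/eqO_exP; exists (11 / ln 2); first by rewrite divr_gt0.
near=> n.
have n2 : (2 <= n)%N by near: n; exact: nbhs_infty_ge.
have n0 : 0 < n%:R :> R by rewrite ltr0n; lia.
have log_le : (trunc_log 2 n)%:R * ln 2 <= ln n%:R :> R.
  rewrite mulr_natl -lnXn// ler_ln ?posrE ?exprn_gt0// -natrX ler_nat.
  by apply: trunc_logP => //; lia.
have log_ge1 : (1 <= trunc_log 2 n)%N by rewrite trunc_log_gt0 n2.
have cost_le : (cost_bound n <= 11 * (n * trunc_log 2 n))%N.
  by rewrite /cost_bound; nia.
rewrite !ger0_norm ?mulr_ge0 ?ler0n ?ln_ge0 ?ler1n//; try lia.
have : (cost_bound n)%:R <= 11 * (n%:R * (trunc_log 2 n)%:R) :> R.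
  by rewrite -!natrM ler_nat.
move=> /le_trans; apply; rewrite -mulrA ler_pM2l// mulrCA ler_pM2l//.
by rewrite mulrC ler_pdivlMr.
Unshelve. all: by end_near.
Qed.

Unset Implicit Arguments.

Theorem proposition4p2 (R : realType) :
  (forall (n : nat) (u : epoint R n), (0 < n)%N ->
     minimizers (@max_feasible R n) (sq_objective u)
       (orth_proj (polar (@simplex_cone R n)) u)) /\
  computable_in_nlogn (fun n => orth_proj (polar (@simplex_cone R n))) /\
  computable_in_nlogn (fun n => orth_proj (@simplex_cone R n)).
Proof.
split; last split.
- move=> n u n0.
  (* The existence of a root of the threshold equation is read off from the final state of the
     program. *)
  have [_ [s [_ _ [_ _ _ ut]]]] := runs_find_threshold u.
  have [_ minE] := minimizers_threshold n0 ut.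
  rewrite (orth_proj_eq minE).
  have [Kcap min_cap] : minimizers (polar (@simplex_cone R n))
    (fun z => enorm (z - u)) (cap u (cell s (2 * n + 4)%N)) by rewrite minE.
  split=> [|y]; rewrite max_feasibleE// => Ky.
  by rewrite !sq_objectiveE ler_sqr ?nnegrE ?sqrtr_ge0//; exact: min_cap.
- exists project_polar, cost_bound.
  split=> [|n u n0]; first exact: cost_bound_nlogn.
  have [k [s [es kT [t ut outE]]]] := runs_project_polar u.
  exists k, s; split=> //; rewrite outE.
  by have [_ /orth_proj_eq] := minimizers_threshold n0 ut.
- exists project_cone, cost_bound.
  split=> [|n u n0]; first exact: cost_bound_nlogn.
  have [k [s [es kT [t ut outE]]]] := runs_project_cone u.
  exists k, s; split=> //; rewrite outE.
  by have [/orth_proj_eq] := minimizers_threshold n0 ut.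
Qed.
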